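(* Let $\mathbf{L}$ be a complete De Morgan Heyting algebra and $U$ a set. Let $\mathcal{U}$ be an $L$-fuzzy operator on $U$ and let $\mathcal{S}_1,\dots,\mathcal{S}_n$ be $L$-fuzzy operators on $U$ such that $\mathcal{U}\leq\mathcal{S}_j$ for every $1\leq j\leq n$. Then there exists a unique $L$-relation $R$ on $U$ such that $\mathsf{U}_R(A)=\mathcal{U}(A)$ for all $A\in\mathcal{F}_L(U)$ if and only if $$\mathcal{U}\Big(\overline{a}\wedge\bigvee_{i\in I} A_i\Big)=\overline{a}\wedge\bigvee_{i\in I}\big(\mathcal{U}(A_i)\wedge\mathcal{S}_1(A_i)\wedge\cdots\wedge\mathcal{S}_n(A_i)\big)$$ for all $a\in L$ and all families $\{A_i\}_{i\in I}\subseteq\mathcal{F}_L(U)$.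
   Context: A De Morgan Heyting algebra is an algebra $\mathbf{L}=(L,\vee,\wedge,\Rightarrow,{}',0,1)$ such that $(L,\vee,\wedge,\Rightarrow,0,1)$ is a Heyting algebra and $'$ satisfies $(x\wedge y)'=x'\vee y'$ and $x''=x$ for all $x,y\in L$. It is called complete if its underlying lattice is complete. An $L$-set on $U$ is a map $A\colon U\to L$; $\mathcal{F}_L(U)$ is the set of all $L$-sets on $U$, with order, $\wedge$ and $\bigvee$ defined pointwise. An $L$-relation on $U$ is a map $R\colon U\times U\to L$, and its upper $L$-approximation operator is $\mathsf{U}_R(A)(x)=\bigvee_{y\in U}(R(x,y)\wedge A(y))$. For $a\in L$, $\overline{a}\in\mathcal{F}_L(U)$ is the constant map with value $a$. An $L$-fuzzy operator on $U$ is any map $\mathcal{F}_L(U)\to\mathcal{F}_L(U)$; for such operators $\mathcal{U}\leq\mathcal{S}$ means $\mathcal{U}(A)\leq\mathcal{S}(A)$ for all $A\in\mathcal{F}_L(U)$. *)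

(* Defs.v *)
From HB Require Import structures.
From mathcomp Require Import all_boot all_order.
From mathcomp Require Import boolp classical_sets functions.

Set Implicit Arguments.
Unset Strict Implicit.
Unset Printing Implicit Defensive.

Import Order.TTheory.
Local Open Scope classical_set_scope.
Local Open Scope order_scope.

(* Carriers of ordered types are choiceTypes. This is no restriction on the   *)
(* algebra L: by boolp, every type has such a structure.                      *)

HB.mixin Record isHeyting d (L : Type) of Order.TBLattice d L := {
  himp : L -> L -> L;
  himpP : forall x y z : L, (x `&` y <= z) = (x <= himp y z)
}.

#[short(type="heytingType")]
HB.structure Definition Heyting d :=
  { L of Order.TBLattice d L & isHeyting d L }.

HB.mixin Record isDeMorgan d (L : Type) of Order.TBLattice d L := {
  dmneg : L -> L;
  dmnegI : forall x y : L, dmneg (x `&` y) = dmneg x `|` dmneg y;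
  dmnegK : forall x : L, dmneg (dmneg x) = x
}.

#[short(type="deMorganHeytingType")]
HB.structure Definition DeMorganHeyting d :=
  { L of Heyting d L & isDeMorgan d L }.

HB.mixin Record isCompleteLattice d (L : Type) of Order.TBLattice d L := {
  has_supremum : forall A : set L, supremums A !=set0;
  has_infimum : forall A : set L, infimums A !=set0
}.

#[short(type="completeDeMorganHeytingType")]
HB.structure Definition CompleteDeMorganHeyting d :=
  { L of DeMorganHeyting d L & isCompleteLattice d L }.

Notation Lset L U := (U -> L) (only parsing).
Notation Lrel L U := (U -> U -> L) (only parsing).
Notation Lfuzzy_op L U := (Lset L U -> Lset L U) (only parsing).

Section Lsets.
Variables (d : Order.disp_t) (L : completeDeMorganHeytingType d).

(* [supremum] returns its first argument on the empty set, hence [\bot].      *)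
Definition Ljoin (I : Type) (f : I -> L) : L := supremum \bot (range f).

(* The order and [`&`] on L-sets, and the order on L-fuzzy operators, are the *)
(* pointwise ones that boolp puts on function types.                          *)
Definition Lset_join (U I : Type) (A : I -> Lset L U) : Lset L U :=
  fun x => Ljoin (fun i => A i x).

Definition upper_approx (U : Type) (R : Lrel L U) : Lfuzzy_op L U :=
  fun A x => Ljoin (fun y => R x y `&` A y).

End Lsets.

(* Main.v *)
Require Import Defs.
From HB Require Import structures.
From mathcomp Require Import all_boot all_order.
From mathcomp Require Import boolp classical_sets functions.

Set Implicit Arguments.
Unset Strict Implicit.
Unset Printing Implicit Defensive.

Import Order.TTheory.
Local Open Scope order_scope.

(* An operator of the form [upper_approx R] commutes with all joins and with
   meets by constants, because meets distribute over joins in a complete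
   Heyting algebra.  Conversely an operator [u] with these two properties is
   determined by its values on singletons, since every L-set [A] is the join
   over [y] of [cst (A y) `&` singleton y]; so [R x y := u (singleton y) x]
   is the only candidate, and it works.  The operators [S j] play no role:
   [u <= S j] makes the meet with them collapse to [u]. *)

Section Joins.
Variables (d : Order.disp_t) (L : completeDeMorganHeytingType d).

(** On an empty range the default [\bot] is the supremum because it is least; on a nonempty one,
    completeness provides a supremum. *)
Lemma Ljoin_le (I : Type) (f : I -> L) (z : L) :
  Ljoin f <= z <-> forall i, f i <= z.
Proof.
have [xub xlub] : supremums (range f) (Ljoin f).
  rewrite /Ljoin /supremum; case: eqP => [f0|_].
    split=> [y|y _]; last exact: le0x.
    by rewrite f0.
  case: xgetP => [y _ //|nosup].
  by have [y /nosup] := has_supremum (range f).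
split=> [fz i|fz].
  by apply: le_trans fz; apply: xub; exists i.
by apply: xlub => _ [i _ <-].
Qed.

Lemma Ljoin_ub (I : Type) (f : I -> L) (i : I) : f i <= Ljoin f.
Proof. exact: (Ljoin_le f (Ljoin f)).1. Qed.

Lemma Ljoin_eq (I : Type) (f : I -> L) (x : L) :
  (forall z, x <= z <-> forall i, f i <= z) -> Ljoin f = x.
Proof.
move=> fx; apply/le_anti/andP; split; first by apply/Ljoin_le/fx.
by apply/fx/Ljoin_ub.
Qed.

(** Residuation: meeting with [a] is left adjoint to [himp a], hence preserves joins. *)
Lemma meet_Ljoin_le (I : Type) (f : I -> L) (a z : L) :
  a `&` Ljoin f <= z <-> forall i, a `&` f i <= z.
Proof.
rewrite meetC himpP Ljoin_le.
by split=> H i; have := H i; rewrite meetC himpP.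
Qed.

Lemma upper_approx_meet_join (U I : Type) (R : Lrel L U) (a : L)
    (A : I -> Lset L U) :
  upper_approx R (cst a `&` Lset_join A) =
  cst a `&` Lset_join (fun i => upper_approx R (A i)).
Proof.
apply/funext => x; apply: Ljoin_eq => z.
(* Both sides say that [z] bounds the meet of [a], [R x y] and [A i y] for all [i] and [y]. *)
change (a `&` Ljoin (fun i => Ljoin (fun y => R x y `&` A i y)) <= z <->
        forall y, R x y `&` (a `&` Ljoin (fun i => A i y)) <= z).
rewrite meet_Ljoin_le; split=> [H y|H i].
  rewrite meetA; apply/meet_Ljoin_le => i.
  by rewrite (meetC (R x y)) -meetA; exact: (meet_Ljoin_le _ _ _).1 (H i) y.
apply/meet_Ljoin_le => y; rewrite meetA (meetC a).
by move: (H y); rewrite meetA => /meet_Ljoin_le.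
Qed.

Definition singleton (U : Type) (y : U) : Lset L U :=
  fun x => if `[< x = y >] then \top else \bot.

(** Only the term at [y = x] can differ from [\bot]. *)
Lemma Ljoin_singleton (U : Type) (f : U -> L) (x : U) :
  Ljoin (fun y => f y `&` singleton y x) = f x.
Proof.
apply: Ljoin_eq => z; split=> [fz y|/(_ x)]; rewrite /singleton.
  by case: asboolP => [<-|_]; rewrite ?meetx1 // meetx0 le0x.
by rewrite asboolT // meetx1.
Qed.

Lemma Lset_join_singleton (U : Type) (A : Lset L U) :
  Lset_join (fun y => cst (A y) `&` singleton y) = A.
Proof. by apply/funext => x; exact: Ljoin_singleton. Qed.

(** Recovers [R] from its operator, which yields uniqueness. It reduces to the symmetry of
    [singleton] in its two points. *)
Lemma upper_approx_singleton (U : Type) (R : Lrel L U) (x y : U) :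
  upper_approx R (singleton y) x = R x y.
Proof.
rewrite -[RHS](Ljoin_singleton (R x) y); congr Ljoin; apply/funext => z.
rewrite /singleton; case: (asboolP (z = y)) => [->|zy]; first by rewrite asboolT.
by rewrite asboolF // => /esym.
Qed.

Lemma upper_approx_representable (U : Type) (u : Lfuzzy_op L U) :
  (exists! R : Lrel L U, forall A, upper_approx R A = u A) <->
  (forall (a : L) (I : Type) (A : I -> Lset L U),
     u (cst a `&` Lset_join A) = cst a `&` Lset_join (fun i => u (A i))).
Proof.
split=> [[R [uR _]] a I A|uP].
  rewrite -uR upper_approx_meet_join; congr (_ `&` Lset_join _).
  by apply/funext => i.
exists (fun x y => u (singleton y) x); split=> [A|R uR]; last first.
  by apply/funext => x; apply/funext => y; rewrite -uR upper_approx_singleton.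
(* Families indexed by [unit] extract from [uP] the compatibility with constants; the constant
   [\top] then isolates the compatibility with joins. *)
have join1 (B : Lset L U) : Lset_join (fun _ : unit => B) = B.
  apply/funext => x; apply: Ljoin_eq => z.
  by split=> [//|/(_ tt)].
have uM a B : u (cst a `&` B) = cst a `&` u B.
  by have := uP a unit (fun=> B); rewrite !join1.
have cst1 (B : Lset L U) : cst \top `&` B = B.
  by apply/funext => x; exact: meet1x.
have := uP \top U (fun y => cst (A y) `&` singleton y).
rewrite !cst1 Lset_join_singleton => ->.
apply/funext => x; congr Ljoin; apply/funext => y.
by rewrite uM meetC.
Qed.

End Joins.

Theorem theorem4p2 (d : Order.disp_t) (L : completeDeMorganHeytingType d)
    (U : Type) (u : Lfuzzy_op L U) (n : nat) (S : 'I_n -> Lfuzzy_op L U)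
    (uS : forall j : 'I_n, u <= S j) :
  (exists! R : Lrel L U, forall A : Lset L U, upper_approx R A = u A) <->
  (forall (a : L) (I : Type) (A : I -> Lset L U),
     u (cst a `&` Lset_join A) =
     cst a `&`
       Lset_join (fun i => u (A i) `&` (fun x => \meet_(j < n) S j (A i) x))).
Proof.
rewrite upper_approx_representable.
have uSE A : u A `&` (fun x => \meet_(j < n) S j A x) = u A.
  apply/funext => x; apply/meet_idPl/meetsP => j _.
  by have /lefP/(_ A)/lefP/(_ x) := uS j.
by split=> uP a I A; rewrite uP; congr (_ `&` Lset_join _);
  apply/funext => i; rewrite uSE.
Qed.
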